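(* The canonical monomial basis $(x^2,xy,y^2)$ of the space of real quadratic forms in two variables with norm $\|\cdot\|_{\mathfrak O}$ has unconditional constant $$\mathbf u_{\mathrm{can}}(\mathfrak O)=3.$$ The constant is attained by $P_*=-x^2+4xy-y^2$; that is, for the coefficient vector $(-1,4,-1)$ and a suitable choice of subset $A$ and signs $\varepsilon_j$, equality holds in the defining inequality of the unconditional constant with $C=3$.
   Context: $\mathfrak O:=\{(x,y)\in[0,1]^2: x+y\le\sqrt2\}$. For a real quadratic form $P(x,y)=ax^2+bxy+cy^2$ put $\|P\|_{\mathfrak O}:=\sup_{(x,y)\in\mathfrak O}|P(x,y)|$. Let $(m_1,m_2,m_3):=(x^2,xy,y^2)$. The canonical unconditional constant $\mathbf u_{\mathrm{can}}(\mathfrak O)$ is the least $C\ge1$ such that $$\left\|\sum_{j\in A}\varepsilon_ja_jm_j\right\|_{\mathfrak O}\le C\left\|\sum_{j=1}^3a_jm_j\right\|_{\mathfrak O}$$ for every $(a_1,a_2,a_3)\in\mathbb R^3$, every subset $A\subset\{1,2,3\}$, and every choice of signs $\varepsilon_j\in\{-1,1\}$. *)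

(* Defs.v *)
From HB Require Import structures.
From mathcomp Require Import all_boot all_order all_algebra.
From mathcomp Require Import classical_sets reals.
Set Implicit Arguments.
Unset Strict Implicit.
Unset Printing Implicit Defensive.
Import Order.TTheory GRing.Theory Num.Theory.
Local Open Scope classical_set_scope.
Local Open Scope ring_scope.

Definition octagon (R : realType) : set (R * R) :=
  [set z | [/\ 0 <= z.1 <= 1, 0 <= z.2 <= 1 & z.1 + z.2 <= Num.sqrt 2]].

(* The supremum is a genuine one for quadratic forms: the octagon is nonempty
   and bounded, so the fallback value [sup _ = 0] never comes into play. *)
Definition octagon_norm (R : realType) (P : R * R -> R) : R :=
  sup [set `|P z| | z in @octagon R].

(* The indices 1, 2, 3 of the monomials x^2, xy, y^2 become 0, 1, 2. *)
Definition monomial2 (R : realType) (j : 'I_3) (z : R * R) : R :=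
  [:: z.1 ^+ 2; z.1 * z.2; z.2 ^+ 2]`_j.

Definition quadratic_form (R : realType) (a : 'rV[R]_3) (z : R * R) : R :=
  \sum_(j < 3) a 0 j * monomial2 j z.

Definition signed_part (R : realType) (A : {set 'I_3}) (eps : 'I_3 -> R)
    (a : 'rV[R]_3) (z : R * R) : R :=
  \sum_(j in A) eps j * a 0 j * monomial2 j z.

Definition is_sign_choice (R : realType) (eps : 'I_3 -> R) : Prop :=
  forall j, eps j = -1 \/ eps j = 1.

Definition unconditional_bound (R : realType) : set R :=
  [set C | 1 <= C /\
    forall (a : 'rV[R]_3) (A : {set 'I_3}) (eps : 'I_3 -> R),
      is_sign_choice eps ->
      octagon_norm (signed_part A eps a)
        <= C * octagon_norm (quadratic_form a)].

Definition is_unconditional_constant (R : realType) (C : R) : Prop :=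
  unconditional_bound C /\ lbound (@unconditional_bound R) C.

Definition Pstar (R : realType) : 'rV[R]_3 :=
  \row_(j < 3) [:: -1; 4; -1]`_j.

Lemma PstarE (R : realType) (x y : R) :
  quadratic_form (Pstar R) (x, y) = - x ^+ 2 + 4 * x * y - y ^+ 2.
Proof.
rewrite /quadratic_form !big_ord_recl big_ord0 !mxE /monomial2 /=.
by rewrite !mulN1r addr0 mulrA addrA.
Qed.

(* Main.v *)
Require Import Defs.
From mathcomp Require Import all_boot all_order all_algebra.
From mathcomp Require Import classical_sets reals.
From mathcomp Require Import lra.
Import Order.TTheory GRing.Theory Num.Theory.
Local Open Scope ring_scope.

(** The monomials are nonnegative on the octagon, so the worst choice of signs
    turns [P = a x^2 + b x y + c y^2] into [|a| x^2 + |b| x y + |c| y^2].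
    The values of [P] at [(1, 0)], [(0, 1)] and [(1/sqrt 2, 1/sqrt 2)] bound
    [|a|], [|c|] and [|a + b + c| / 2] by the norm [N], hence [|b| <= 4 N], and
    the modified form is at most [N (x^2 + 4 x y + y^2) <= 3 N], because
    [x^2 + 4 x y + y^2 <= 3 (x + y)^2 / 2].  For [Pstar] all these inequalities
    are equalities at [(1/sqrt 2, 1/sqrt 2)]. *)

Section OctagonNorm.
Variable R : realType.
Implicit Types (P : R * R -> R) (M x y : R) (z : R * R) (a : 'rV[R]_3).

(** Squaring the last constraint removes the square root, leaving polynomial inequalities for [lra]
    and [nra]. *)
Lemma octagonP x y : octagon (x, y) ->
  [/\ 0 <= x <= 1, 0 <= y <= 1 & (x + y) ^+ 2 <= 2].
Proof.
case=> /= xb yb xy; split=> //.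
have xy0 : 0 <= x + y by lra.
by rewrite -(sqr_sqrtr (ler0n R 2)) ler_sqr ?nnegrE ?sqrtr_ge0.
Qed.

Lemma octagonE x y : 0 <= x <= 1 -> 0 <= y <= 1 -> (x + y) ^+ 2 <= 2 ->
  octagon (x, y).
Proof.
move=> xb yb xy; split=> //=.
have xy0 : 0 <= x + y by lra.
by rewrite -(ger0_norm xy0) -sqrtr_sqr ler_wsqrtr.
Qed.

Lemma octagon_norm_le P M :
  (forall z, octagon z -> `|P z| <= M) -> octagon_norm P <= M.
Proof.
move=> PM; apply: ge_sup => [|_ [z zO <-]]; last exact: PM.
by exists `|P (0, 0)|; exists (0, 0) => //; apply: octagonE; lra.
Qed.

(** The bound [M] ensures that the supremum is genuine and not a default value. *)
Lemma le_octagon_norm P M z : (forall z', octagon z' -> `|P z'| <= M) ->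
  octagon z -> `|P z| <= octagon_norm P.
Proof.
move=> PM zO; apply: ub_le_sup; last by exists z.
by exists M => _ [z' z'O <-]; exact: PM.
Qed.

Lemma monomial2_ge0 j z : octagon z -> 0 <= monomial2 j z.
Proof.
case: z => x y /octagonP[/andP[x0 _] /andP[y0 _] _].
case: j => -[|[|[|//]]] lt_j3; rewrite /monomial2 /= ?sqr_ge0 //.
exact: mulr_ge0.
Qed.

Lemma monomial2_le1 j z : octagon z -> monomial2 j z <= 1.
Proof.
case: z => x y /octagonP[xb yb _].
by case: j => -[|[|[|//]]] lt_j3; rewrite /monomial2 /=; nra.
Qed.

Lemma quadratic_formE a x y :
  quadratic_form a (x, y)
  = a 0 0 * x ^+ 2 + a 0 1 * (x * y) + a 0 2%:R * y ^+ 2.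
Proof.
rewrite /quadratic_form !big_ord_recl big_ord0 addr0 addrA /monomial2 /=.
by congr (a 0 _ * _ + a 0 _ * _ + a 0 _ * _); apply: val_inj.
Qed.

Lemma signed_part_le (A : {set 'I_3}) (eps : 'I_3 -> R) a z :
  is_sign_choice eps -> octagon z ->
  `|signed_part A eps a z| <= quadratic_form (\row_j `|a 0 j|) z.
Proof.
move=> epsP zO; apply: le_trans (ler_norm_sum _ _ _) _.
rewrite big_mkcond; apply: ler_sum => j _; rewrite mxE.
have m_ge0 := monomial2_ge0 j z zO.
(* An index outside [A] contributes zero on the left and a nonnegative term on the right. *)
case: ifP => _; last exact: mulr_ge0.
have eps1 : `|eps j| = 1 by case: (epsP j) => ->; rewrite ?normrN1 ?normr1.
by rewrite !normrM eps1 mul1r (ger0_norm m_ge0).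
Qed.

(** This crude bound serves to show that the values on the octagon are bounded, as [le_octagon_norm]
    requires. *)
Lemma quadratic_form_le a z :
  octagon z -> `|quadratic_form a z| <= \sum_j `|a 0 j|.
Proof.
move=> zO; apply: le_trans (ler_norm_sum _ _ _) _.
apply: ler_sum => j _; rewrite normrM ler_piMr //.
by rewrite (ger0_norm (monomial2_ge0 j z zO)) monomial2_le1.
Qed.

Lemma quadratic_form_le_norm a z :
  octagon z -> `|quadratic_form a z| <= octagon_norm (quadratic_form a).
Proof. by apply: le_octagon_norm => z' /quadratic_form_le; apply. Qed.

(** The midpoint of the edge [x + y = sqrt 2]. *)
Definition diagonal_point : R * R := ((Num.sqrt 2)^-1, (Num.sqrt 2)^-1).

Lemma sqr_diagonal : (Num.sqrt 2)^-1 ^+ 2 = 2^-1 :> R.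
Proof. by rewrite exprVn sqr_sqrtr // ler0n. Qed.

Lemma octagon_diagonal : octagon diagonal_point.
Proof.
have h0 : 0 <= (Num.sqrt 2)^-1 :> R by rewrite invr_ge0 sqrtr_ge0.
by have h2 := sqr_diagonal; apply: octagonE; nra.
Qed.

Lemma quadratic_form_diagonal a :
  quadratic_form a diagonal_point = (a 0 0 + a 0 1 + a 0 2%:R) / 2.
Proof. by rewrite quadratic_formE -expr2 sqr_diagonal !mulrDl. Qed.

Lemma abs_form_le (a b c N x y : R) : 0 <= x -> 0 <= y ->
    (x + y) ^+ 2 <= 2 ->
    `|a| <= N -> `|c| <= N -> `|(a + b + c) / 2| <= N ->
  `|a| * x ^+ 2 + `|b| * (x * y) + `|c| * y ^+ 2 <= 3 * N.
Proof.
move=> x0 y0 xy2 aN cN dN.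
have N0 : 0 <= N := le_trans (normr_ge0 a) aN.
(* Write [b = 2 * ((a + b + c) / 2) - a - c]. *)
have bN : `|b| <= 4 * N.
  move: aN cN dN; rewrite !ler_norml => /andP[? ?] /andP[? ?] /andP[? ?].
  by apply/andP; split; lra.
have ax : `|a| * x ^+ 2 <= N * x ^+ 2 by rewrite ler_wpM2r ?sqr_ge0.
have cy : `|c| * y ^+ 2 <= N * y ^+ 2 by rewrite ler_wpM2r ?sqr_ge0.
have bm : `|b| * (x * y) <= 4 * N * (x * y) by rewrite ler_wpM2r ?mulr_ge0.
have : N * (x ^+ 2 + 4 * (x * y) + y ^+ 2) <= N * 3.
  (* The difference [3 (x + y)^2 / 2 - (x^2 + 4 x y + y^2)] equals [(x - y)^2 / 2]. *)
  by rewrite ler_wpM2l //; have := sqr_ge0 (x - y); lra.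
lra.
Qed.

Lemma unconditional_bound3 : @unconditional_bound R 3.
Proof.
split=> [|a A eps epsP]; first lra.
apply: octagon_norm_le => -[x y] zO.
apply: le_trans (signed_part_le A eps a _ epsP zO) _.
rewrite quadratic_formE !mxE.
have [/andP[x0 _] /andP[y0 _] xy2] := octagonP _ _ zO.
have PN := quadratic_form_le_norm a; apply: abs_form_le => //.
- have := PN (1, 0); rewrite quadratic_formE => /(_ _).
  by rewrite expr1n expr0n !mulr0 !addr0 mulr1; apply; apply: octagonE; lra.
- have := PN (0, 1); rewrite quadratic_formE => /(_ _).
  by rewrite expr1n expr0n mul0r !mulr0 !add0r mulr1; apply; apply: octagonE; lra.
- by rewrite -quadratic_form_diagonal; apply/PN/octagon_diagonal.
Qed.

Lemma octagon_norm_Pstar : octagon_norm (quadratic_form (Pstar R)) = 1.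
Proof.
apply/eqP; rewrite eq_le; apply/andP; split.
  apply: octagon_norm_le => -[x y] /octagonP[xb yb xy2].
  (* Above, the form is [(x + y)^2 / 2 - 3 (x - y)^2 / 2 <= 1]. Below, if [x <= y] then
     [x^2 <= 4 x y] and [y^2 <= 1]; the other case is symmetric. *)
  rewrite PstarE ler_norml; have [xy|yx] := lerP x y; nra.
have := quadratic_form_le_norm (Pstar R) _ octagon_diagonal.
rewrite quadratic_form_diagonal !mxE /=; apply: le_trans.
by rewrite ler_normr; apply/orP; left; lra.
Qed.

(** The signs of the coefficients of [Pstar], which turn it into [x^2 + 4 x y + y^2]. *)
Definition extremal_signs (j : 'I_3) : R := if j == 1 then 1 else -1.

Lemma extremal_signsP : is_sign_choice extremal_signs.
Proof. by move=> j; rewrite /extremal_signs; case: eqP; [right | left]. Qed.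

Lemma extremal_signed_part :
  3 <= octagon_norm (signed_part finset.setT extremal_signs (Pstar R)).
Proof.
have bound z := signed_part_le finset.setT _ (Pstar R) z extremal_signsP.
have PM z (zO : octagon z) := le_trans (bound z zO)
  (le_trans (ler_norm _) (quadratic_form_le _ z zO)).
apply: le_trans (le_octagon_norm _ _ _ PM octagon_diagonal).
rewrite ler_normr; apply/orP; left.
(* Over the full index set the signed part is again a quadratic form, with diagonal value
   [(1 + 4 + 1) / 2 = 3]. *)
have -> : signed_part finset.setT extremal_signs (Pstar R) diagonal_point
    = quadratic_form (\row_j (extremal_signs j * Pstar R 0 j)) diagonal_point.
  by apply: eq_big => [j|j _]; rewrite ?inE ?mxE.
rewrite quadratic_form_diagonal !mxE /extremal_signs /=; lra.
Qed.

End OctagonNorm.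

Theorem theorem6p6 (R : realType) :
  is_unconditional_constant (3 : R) /\
  (exists (A : {set 'I_3}) (eps : 'I_3 -> R),
     is_sign_choice eps /\
     octagon_norm (signed_part A eps (Pstar R))
       = 3 * octagon_norm (quadratic_form (Pstar R))).
Proof.
have lower := @extremal_signed_part R; have signs := @extremal_signsP R.
have bound3 := @unconditional_bound3 R.
split; first split=> //.
  (* Any admissible [C] satisfies [3 <= C * 1], since [Pstar] has norm 1. *)
  move=> C [_ /(_ (Pstar R) _ _ signs)/(le_trans lower)].
  by rewrite octagon_norm_Pstar mulr1.
exists finset.setT, (extremal_signs R); split=> //.
apply/eqP; rewrite eq_le (bound3.2 _ _ _ signs) /=.
by rewrite octagon_norm_Pstar mulr1.
Qed.
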